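(* Let $G_1=(V_1,E_1)$ and $G_2=(V_2,E_2)$ be two graphs, each with $n$ vertices, let $d_1$ be the maximum degree of $G_1$ and $d_2$ the maximum degree of $G_2$. Suppose the girth of each of $G_1,G_2$ is at least $g>2$, and let $k$ be the largest integer satisfying $$1+(d_1+d_2)+(d_1+d_2)(d_1+d_2-1)+\cdots+(d_1+d_2)(d_1+d_2-1)^{k-1}<n.$$ Then there is a packing of $G_1$ and $G_2$ such that the combined graph has girth at least $\min\{g,k\}$.
   Context: Two $n$-vertex graphs $G_1,G_2$ pack if there is an edge-disjoint placement of them on a common set of $n$ vertices, i.e. bijections $f_i:V_i\to V$ ($|V|=n$) such that the images of $E_1$ and $E_2$ are disjoint; the combined graph is the graph on $V$ whose edge set is the union of the two images. The girth of a graph is the length of its shortest cycle (infinite if it has no cycle).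
   Formalization: The hypothesis k ≥ 2 is added: for k = 1 the claim fails, e.g. for G_1 = K_{5,5}, G_2 = C_10 with n = 10, g = 3, which do not pack; k = 0 fails similarly for K_n and a graph with one edge. *)

(* Defs.v *)
From mathcomp Require Import all_boot.

Set Implicit Arguments.
Unset Strict Implicit.
Unset Printing Implicit Defensive.

Record sgraph := SGraph {
  vertex :> finType;
  adj : rel vertex;
  adj_sym : symmetric adj;
  adj_irr : irreflexive adj
}.
Arguments adj : clear implicits.

Definition max_degree (G : sgraph) : nat := \max_(x : G) #|[set y | adj G x y]|.

(* The bound 2 < size c matters: [:: x; y] is a cycle in the sense of path.v
   as soon as e x y and e y x hold. *)
Definition graph_cycle (T : finType) (e : rel T) (c : seq T) : bool :=
  (2 < size c) && ucycleb e c.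

(* None stands for infinite girth. Since the vertices of a cycle are distinct,
   lengths up to #|T| suffice; see girth_geP. *)
Definition girth (T : finType) (e : rel T) : option nat :=
  ohead [seq l <- iota 0 #|T|.+1 | [exists c : l.-tuple T, graph_cycle e c]].

Definition girth_ge (T : finType) (e : rel T) (m : nat) : bool :=
  if girth e is Some l then m <= l else true.

Lemma girth_geP (T : finType) (e : rel T) (m : nat) :
  girth_ge e m <-> (forall c : seq T, graph_cycle e c -> m <= size c).
Proof.
rewrite /girth_ge /girth.
set P := fun l => [exists c : l.-tuple T, graph_cycle e c].
have inP c : graph_cycle e c -> size c \in [seq l <- iota 0 #|T|.+1 | P l].
  move=> cc; rewrite mem_filter mem_iota /= add0n ltnS; apply/andP; split.
    by apply/existsP; exists (in_tuple c).
  by case/andP: cc => _ /andP[_ /card_uniqP <-]; apply: max_card.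
have: sorted leq [seq l <- iota 0 #|T|.+1 | P l].
  by apply: (sorted_filter leq_trans); apply: iota_sorted.
case Es: [seq l <- iota 0 #|T|.+1 | P l] => [|l s] /= srt.
  by split=> // _ c /inP; rewrite Es.
split=> [ml c /inP|H].
  rewrite Es inE => /orP[/eqP-> //|sc].
  by apply: leq_trans ml _; move/(order_path_min leq_trans)/allP: srt => ->.
have: l \in [seq l <- iota 0 #|T|.+1 | P l] by rewrite Es mem_head.
by rewrite mem_filter => /andP[/existsP[c /H]]; rewrite size_tuple.
Qed.

Definition image_adj (G : sgraph) (V : finType) (f : G -> V) : rel V :=
  fun x y => [exists u, exists v, [&& f u == x, f v == y & adj G u v]].

Definition packing (G1 G2 : sgraph) (V : finType)
    (f1 : G1 -> V) (f2 : G2 -> V) : Prop :=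
  [/\ bijective f1, bijective f2
    & forall x y, ~~ (image_adj f1 x y && image_adj f2 x y)].

Definition combined (G1 G2 : sgraph) (V : finType)
    (f1 : G1 -> V) (f2 : G2 -> V) : rel V :=
  fun x y => image_adj f1 x y || image_adj f2 x y.

(* 1 + d + d(d-1) + ... + d(d-1)^(k-1); truncated subtraction is harmless, as
   every term has a factor d. *)
Definition ball_bound (d k : nat) : nat := 1 + \sum_(i < k) d * (d - 1) ^ i.

Definition largest_radius (d n k : nat) : Prop :=
  ball_bound d k < n /\ (forall j, ball_bound d j < n -> j <= k).

(* Main.v *)
Require Import Defs.
From mathcomp Require Import all_boot fingroup perm zify.

(* Colour the edges by the graph they come from, and count a doubly covered
   edge as a cycle of length 2.  Among the placements without cycles shorter
   than L, where L < g and L <= k, take one with the fewest cycles of length L.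
   If there is such a cycle, it has both colours since L < g, so it changes
   colour at some u.  The ball of radius k around u in the combined graph has
   at most 1 + d + ... + d(d-1)^(k-1) < n vertices, so some v is at distance
   more than k from u; exchange u and v in the placement of G2.  This breaks
   the cycle at u.  A new closed walk of length at most L would decompose into
   at least two walks of the old graph between vertices of {u, v}; none joins
   u to v, so each is an old closed walk, of length at least L, which is too
   long.  So the number of L-cycles drops.  Running this up to L = min(g-1, k)
   also removes the 2-cycles, so the result is a packing.

   Cycles are replaced throughout by closed walks without backtracking (except
   possibly at the base point): the shortest ones are the shortest cycles, and
   such walks are easier to cut and to count. *)

Set Implicit Arguments.
Unset Strict Implicit.
Unset Printing Implicit Defensive.

(** * Bounds for unions and repeated values in lists *)

Lemma leq_card_bigcup (I T : finType) (A : {pred I}) (F : I -> {set T}) (m : nat) :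
  (forall i, i \in A -> #|F i| <= m) -> #|\bigcup_(i in A) F i| <= #|A| * m.
Proof.
move=> Fm; rewrite -sum_nat_const.
elim/big_ind2: _ => [|S a S' b Sa S'b|i /Fm //]; first by rewrite cards0.
by rewrite cardsU (leq_trans (leq_subr _ _)) // leq_add.
Qed.

Lemma nonuniq_map_split (T U : eqType) (f : T -> U) (p : seq T) :
  ~~ uniq (map f p) ->
  exists p1 d p2 e p3, p = p1 ++ d :: p2 ++ e :: p3 /\ f d = f e.
Proof.
elim: p => //= d p IHp; rewrite negb_and negbK => /orP[|/IHp].
  by case/mapP=> e /splitPr[p2 p3] fde; exists [::], d, p2, e, p3.
case=> p1 [d' [p2 [e [p3 [-> fde]]]]].
by exists (d :: p1), d', p2, e, p3.
Qed.

(** * Walks without backtracking and their relation to girth *)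

Section Walks.

Variable V : finType.

(* A dart is an edge of one of the two graphs, given by its colour, together
   with an orientation. *)
Definition dart : Type := (bool * (V * V))%type.
Definition col (d : dart) : bool := d.1.
Definition src (d : dart) : V := d.2.1.
Definition tgt (d : dart) : V := d.2.2.
Definition flip (d : dart) : dart := (d.1, (d.2.2, d.2.1)).

Lemma dart_eqP (d e : dart) :
  col d = col e -> src d = src e -> tgt d = tgt e -> d = e.
Proof. by case: d e => [b [x y]] [b' [x' y']]; rewrite /col /src /tgt /= => -> -> ->. Qed.

(** As [flip] keeps the colour, going along a doubly covered edge in one colour and back in the
    other is reduced: this is how such edges become closed walks of length 2. *)
Definition reduced (p : seq dart) : bool :=
  sorted (fun d e => e != flip d) p.

Definition dest (x : V) (p : seq dart) : V := last x (map tgt p).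

Lemma dest_cat x p q : dest x (p ++ q) = dest (dest x p) q.
Proof. by rewrite /dest map_cat last_cat. Qed.

Variable E : pred dart.

Fixpoint walk (x : V) (p : seq dart) : bool :=
  if p is d :: q then [&& E d, src d == x & walk (tgt d) q] else true.

Definition closed_walk (x : V) (p : seq dart) : bool :=
  [&& walk x p, reduced p & dest x p == x].

Definition no_short_closed (m : nat) : Prop :=
  forall x p, closed_walk x p -> size p < m -> p = [::].

Lemma walk_cat x p q : walk x (p ++ q) = walk x p && walk (dest x p) q.
Proof. by elim: p x => //= d p IHp x; rewrite IHp !andbA. Qed.

Lemma reduce_walk x p : walk x p ->
  exists q, [/\ walk x q, reduced q, dest x q = dest x p & size q <= size p].
Proof.
elim: p x => [|d p IHp] x /=; first by exists [::].
case/and3P=> Ed /eqP <- /IHp [[|e q]] [/= wq rq dq sq].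
  by exists [:: d]; rewrite /= Ed eqxx; split.
case/and3P: wq => Ee /eqP se wq.
have [eq_e|ne_e] := eqVneq e (flip d); last first.
  by exists (d :: e :: q); rewrite /= Ed Ee se !eqxx wq ne_e; split.
(* [d] cancels against the first dart of the reduced tail. *)
rewrite eq_e in wq dq; exists q; split => //.
- by move: rq => /path_sorted.
- exact: leqW (ltnW sq).
Qed.

Lemma walk_path (r : rel V) x (p : seq dart) :
  (forall d, d \in p -> r (src d) (tgt d)) -> walk x p ->
  path r x (map tgt p).
Proof.
elim: p x => //= d p IHp x rp /and3P[_ /eqP <- wp].
rewrite rp ?mem_head //=; apply: IHp => // e ep; apply: rp.
by rewrite inE ep orbT.
Qed.

Lemma walk_rcons_src x p :
  walk x p -> rcons (map src p) (dest x p) = x :: map tgt p.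
Proof. by elim: p x => //= d p IHp x /and3P[_ /eqP -> /IHp <-]. Qed.

(** A closed walk that repeats no source is a cycle; otherwise the piece between two visits to a
    vertex is a shorter closed walk. *)
Lemma girth_closed_walk (r : rel V) (g : nat) (b : bool) x (p : seq dart) :
    irreflexive r -> (forall c, graph_cycle r c -> g <= size c) ->
    (forall d, d \in p -> col d = b /\ r (src d) (tgt d)) ->
    p != [::] -> closed_walk x p ->
  g <= size p.
Proof.
move=> r_irr girth_r; have [n] := ubnP (size p).
elim: n => // n IHn in x p * => sp rp p_neq0 /and3P[wp redp /eqP dp].
have [uniq_p|/nonuniq_map_split] := boolP (uniq (map src p)).
  rewrite -(size_map src); apply: girth_r; rewrite /graph_cycle /ucycleb uniq_p.
  have rpt: path r x (map tgt p) by apply: walk_path wp => d /rp[].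
  have := walk_rcons_src wp; rewrite dp.
  case: p {IHn sp uniq_p dp} rp p_neq0 wp redp rpt => // d p rp _ wp redp rpt.
  case/and3P: (wp) => _ /eqP sd w'; rewrite [map src _]/= sd => -[Hq].
  rewrite andbT /= Hq; apply/andP; split; last exact: rpt.
  (* Length 1 would be a loop, and length 2 a backtrack within one colour. *)
  case: p rp wp w' redp {rpt} Hq => [|e [|//]] rp wp w' redp /=.
    move=> [dt]; case: (rp d (mem_head _ _)) => _.
    by rewrite sd dt r_irr.
  case=> se te; case/andP: redp => /negP[]; apply/eqP.
  have [c1 _] := rp d (mem_head _ _).
  have [|c2 _] := rp e; first by rewrite !inE eqxx orbT.
  by apply: dart_eqP; [rewrite c2 -c1 | | rewrite -te -sd].
case=> p1 [d [p2 [e [p3 [eqp sde]]]]]; subst p.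
have lt_sz: size (d :: p2) < size (p1 ++ d :: p2 ++ e :: p3).
  by rewrite !size_cat /= !size_cat /=; lia.
apply: leq_trans (ltnW lt_sz).
move: wp redp dp; rewrite -[d :: p2 ++ _]/((d :: p2) ++ _) !walk_cat.
case/and3P=> w1 w2 w3 redp _.
have sd: src d = dest x p1 by case/and3P: w2 => _ /eqP.
apply: (IHn (src d)) => //.
- by apply: leq_trans lt_sz _; rewrite -ltnS.
- by move=> f fp; apply: rp; rewrite mem_cat -cat_cons mem_cat fp orbT.
apply/and3P; split; first by rewrite sd.
  by move: redp => /cat_sorted2[_ /cat_sorted2[]].
by rewrite sd; case/and3P: w3 => _ /eqP <-; rewrite -sde sd.
Qed.
End Walks.

(** * Counting the vertices within reach *)

Section Reach.

Variables (V : finType) (E : pred (dart V)).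
Hypothesis E_flip : forall d, E (flip d) = E d.

Lemma walk_rev x p : walk E x p ->
  exists q, [/\ walk E (dest x p) q, dest (dest x p) q = x & size q = size p].
Proof.
elim: p x => [|d p IHp] x /=; first by exists [::].
case/and3P=> Ed /eqP <- /IHp [q [wq dq sq]].
exists (q ++ [:: flip d]); rewrite walk_cat dest_cat size_cat sq addn1.
by rewrite wq dq /= E_flip Ed eqxx.
Qed.

Definition out (x : V) : {set dart V} := [set d | E d & src d == x].

(* The possible last darts of the reduced walks with i.+1 darts from x. *)
Fixpoint frontier (x : V) (i : nat) : {set dart V} :=
  if i is j.+1 then \bigcup_(d in frontier x j) (out (tgt d) :\ flip d)
  else out x.

Lemma frontier_dart x i d : d \in frontier x i -> E d.
Proof.
case: i => [|i] /=; first by rewrite inE => /andP[].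
by case/bigcupP=> e _; rewrite !inE => /and3P[].
Qed.

Lemma card_frontier D x i :
  (forall y, #|out y| <= D) -> #|frontier x i| <= D * (D - 1) ^ i.
Proof.
move=> outD; elim: i => [|i IHi] /=; first by rewrite muln1.
rewrite expnSr mulnA; apply: leq_trans (leq_mul IHi (leqnn _)).
apply: leq_card_bigcup => d /frontier_dart Ed.
(* [flip d] is itself a dart out of [tgt d], so at most [D - 1] continuations remain. *)
have := outD (tgt d); rewrite (cardsD1 (flip d)) !inE E_flip Ed eqxx => lt_D.
by rewrite subn1 -ltnS (ltn_predK lt_D).
Qed.

Lemma frontier_walk x i d p : d \in frontier x i ->
    walk E (tgt d) p -> reduced (d :: p) ->
  last d p \in frontier x (i + size p).
Proof.
elim: p i d => [|e p IHp] i d /= fd; first by rewrite addn0.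
case/and3P=> Ee /eqP se wp /andP[ne redp]; rewrite addnS -addSn.
apply: IHp => //=; apply/bigcupP; exists d => //.
by rewrite !inE ne Ee se eqxx.
Qed.

Lemma exists_far D k x :
    (forall y, #|out y| <= D) -> ball_bound D k < #|V| ->
  exists y, forall p, walk E x p -> dest x p = y -> k < size p.
Proof.
move=> outD small.
(* [B] is the ball of radius [k] around [x]; reduced walks suffice to reach all of it, since
   reducing a walk does not lengthen it. *)
pose B := x |: \bigcup_(i < k) [set tgt d | d in frontier x i].
have: #|B| <= ball_bound D k.
  rewrite cardsU1; apply: leq_add; first exact: leq_b1.
  elim/big_ind2: _ => [|S a S' b Sa S'b|i _]; first by rewrite cards0.
    by rewrite cardsU (leq_trans (leq_subr _ _)) // leq_add.
  exact: leq_trans (leq_imset_card _ _) (card_frontier _ _ outD).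
move=> /leq_ltn_trans/(_ small) cardB.
have [y yB]: exists y, y \notin B.
  apply/existsP; rewrite -negb_forall; apply: contraL cardB => /forallP allB.
  by rewrite -leqNgt -cardsT subset_leq_card //; apply/subsetP => y _.
exists y => p /reduce_walk[q [wq rq dq sq]] dp.
apply: leq_trans sq; rewrite ltnNge; apply: contra yB.
rewrite -dp -dq; case: q wq rq {dq} => [|d q] /=; first by rewrite setU11.
case/and3P=> Ed /eqP sd wq rq szq; rewrite inE; apply/orP; right.
apply/bigcupP; exists (Ordinal szq) => //; apply/imsetP; exists (last d q).
  by rewrite -[Ordinal _ : nat]add0n frontier_walk //= inE Ed sd eqxx.
by rewrite /dest /= last_map.
Qed.

End Reach.

(** * Exchanging two vertices in the placement of the second graph *)

Definition edge (V : finType) (A B : rel V) (d : dart V) : bool :=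
  (if col d then A else B) (src d) (tgt d).

Section Swap.

Variables (V : finType) (A B : rel V) (u v : V).

Definition swap_rel : rel V := relpre (tperm u v) B.

(** Translates darts between the placements before and after the exchange, by [edge_swap]; being an
    involution, it serves both directions. *)
Definition swap_dart (d : dart V) : dart V :=
  if col d then d else (false, (tperm u v (src d), tperm u v (tgt d))).

Lemma swap_dartK : involutive swap_dart.
Proof. by case=> [[] [x y]] //; rewrite /swap_dart /= /src /tgt /= !tpermK. Qed.

Lemma flip_swap_dart d : flip (swap_dart d) = swap_dart (flip d).
Proof. by case: d => [[] []]. Qed.

Lemma reduced_swap p : reduced p -> reduced (map swap_dart p).
Proof.
rewrite /reduced sorted_map; apply: sub_sorted => d e /=.
by rewrite flip_swap_dart (inj_eq (can_inj swap_dartK)).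
Qed.

Lemma edge_swap d : edge A B (swap_dart d) = edge A swap_rel d.
Proof. by case: d => [[] []]. Qed.

Lemma dest_swap x d p :
  dest x (map swap_dart (d :: p)) = tgt (swap_dart (last d p)).
Proof. by rewrite /dest /= -map_comp; apply: (last_map (@tgt V \o swap_dart)). Qed.

(* At a junction of two darts, the swap can only separate them by sending one
   to [u] and the other to [v]. *)
Lemma swap_gap d e : tgt d = src e -> tgt (swap_dart d) != src (swap_dart e) ->
  tgt (swap_dart d) \in [:: u; v] /\ src (swap_dart e) \in [:: u; v].
Proof.
case: d e => [[] [x y]] [[] [x' y']]; rewrite /swap_dart /src /tgt /= => <-;
  rewrite ?eqxx //; case: tpermP => [->|->|]; rewrite ?eqxx // => *;
  by rewrite !inE !eqxx ?orbT.
Qed.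

(** The cut is made at the first junction whose images no longer meet. *)
Lemma walk_swap_split x d q : walk (edge A swap_rel) x (d :: q) ->
  walk (edge A B) (src (swap_dart d)) (map swap_dart (d :: q)) \/
  exists q1 e q2, [/\ q = q1 ++ e :: q2,
    walk (edge A B) (src (swap_dart d)) (map swap_dart (d :: q1)),
    tgt (last d q1) = src e &
    tgt (swap_dart (last d q1)) != src (swap_dart e)].
Proof.
elim: q x d => [|e q IHq] x d /and3P[Ed _ wq].
  by left; rewrite /= edge_swap Ed eqxx.
have tde: tgt d = src e by case/and3P: wq => _ /eqP.
have [gap|gap] := eqVneq (tgt (swap_dart d)) (src (swap_dart e)); last first.
  by right; exists [::], e, q; rewrite /= edge_swap Ed eqxx.
case: (IHq _ _ wq) => [w|[q1 [f [q2 [-> w tf nf]]]]].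
  by left; rewrite map_cons [walk _ _ _]/= edge_swap Ed eqxx gap.
right; exists (e :: q1), f, q2; split=> //.
by rewrite map_cons [walk _ _ _]/= edge_swap Ed eqxx gap.
Qed.

Variables (k L : nat).
Hypothesis L_le_k : L <= k.
Hypothesis no_short : no_short_closed (edge A B) L.
Hypothesis far : forall a p, a \in [:: u; v] -> dest a p \in [:: u; v] ->
  walk (edge A B) a p -> size p <= k -> dest a p = a.

(** If shorter than [L], the segment could not join [u] to [v] by [far], so it would be closed,
    against [no_short]. *)
Lemma swap_segment_size d q :
    walk (edge A B) (src (swap_dart d)) (map swap_dart (d :: q)) ->
    reduced (d :: q) -> src (swap_dart d) \in [:: u; v] ->
    tgt (swap_dart (last d q)) \in [:: u; v] ->
  L <= size (d :: q).
Proof.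
move=> w red_dq suv tuv; rewrite leqNgt; apply/negP => short.
have: map swap_dart (d :: q) = [::]; last by [].
apply: (@no_short (src (swap_dart d))); last by rewrite size_map.
rewrite /closed_walk w reduced_swap //=; apply/eqP; apply: far w _ => //.
  by rewrite dest_swap.
by rewrite size_map; lia.
Qed.

Lemma closed_walk_swap x p :
    closed_walk (edge A swap_rel) x p -> size p <= L ->
  exists y, closed_walk (edge A B) y (map swap_dart p).
Proof.
case: p => [|d q]; first by exists x; rewrite /closed_walk /= eqxx.
case/and3P=> w red_dq /eqP dx sz.
have dq: tgt (last d q) = src d.
  by case/and3P: w => _ /eqP -> _; rewrite -dx /dest /= last_map.
case: (walk_swap_split w) => [wB|[q1 [e [q2 [eq_q w1 te ne]]]]].
  (* No inner gap: a gap at the base point would make the image a walk of at most [k] darts between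
     [u] and [v]. *)
  exists (src (swap_dart d)); rewrite /closed_walk wB reduced_swap //=.
  rewrite -[swap_dart d :: _]/(map swap_dart (d :: q)) dest_swap; apply: contraT => ne.
  have [tuv suv] := swap_gap dq ne.
  case/negP: ne; apply/eqP; rewrite -(dest_swap (src (swap_dart d))).
  by apply: far wB _ => //; rewrite ?dest_swap // size_map; lia.
have [tuv suv] := swap_gap te ne.
have sz_q: size q = size q1 + (size q2).+1 by rewrite eq_q size_cat.
have [red1 red2]: reduced (d :: q1) * reduced (e :: q2).
  by apply: cat_sorted2; rewrite /= -eq_q.
have we: walk (edge A swap_rel) (src e) (e :: q2).
  move: w; rewrite eq_q -cat_cons walk_cat => /andP[_].
  by rewrite /dest /= last_map te.
case: (walk_swap_split we) => [w2|[r1 [f [r2 [eq_q2 w2 tf nf]]]]]; last first.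
  (* A second inner gap: the segment between the gaps omits [d], so it is shorter than [L]. *)
  have red_r: reduced (e :: r1).
    by move: red2; rewrite eq_q2 -cat_cons => /cat_sorted2[].
  have [tuv' _] := swap_gap tf nf.
  have := swap_segment_size w2 red_r suv tuv'.
  by move: sz sz_q; rewrite eq_q2 /= size_cat /=; lia.
have lastq: last e q2 = last d q by rewrite eq_q last_cat.
have [joined|gap] := eqVneq (tgt (swap_dart (last e q2))) (src (swap_dart d)).
  (* One inner gap and none at the base point: rotated to start at the gap, the image is a single
     walk, which [far] closes up. *)
  have w21: walk (edge A B) (src (swap_dart e)) (map swap_dart ((e :: q2) ++ d :: q1)).
    by rewrite map_cat walk_cat w2 dest_swap joined.
  case/eqP: ne; rewrite -(dest_swap (src (swap_dart d))) -joined.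
  rewrite -(dest_swap (src (swap_dart e)) e q2) -dest_cat -map_cat.
  apply: far w21 _ => //; first by rewrite map_cat dest_cat dest_swap.
  by rewrite size_map size_cat /=; move: sz sz_q => /=; lia.
(* Gaps at both places: [d :: q1] omits [e], so it is again too short. *)
rewrite lastq in gap; have [_ suvd] := swap_gap dq gap.
have := swap_segment_size w1 red1 suvd tuv.
by move: sz sz_q => /=; lia.
Qed.

Lemma no_short_closed_swap : no_short_closed (edge A swap_rel) L.
Proof.
move=> x p cp sz; have [y cy] := closed_walk_swap cp (ltnW sz).
by have := no_short cy; rewrite size_map; case: (p) sz => //= d q sz /(_ sz).
Qed.

End Swap.

(** * The number of shortest closed walks drops *)

Section Count.

Variables (V : finType).

Definition closed_walks (E : pred (dart V)) (L : nat) : {set L.-tuple (dart V)} :=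
  [set p : L.-tuple (dart V) | [exists x, closed_walk E x p]].

(* A closed walk that changes colour at [u] is broken by the swap. *)
Lemma card_closed_walks_swap (A B : rel V) u v k L (p1 p2 : seq (dart V)) d e y :
    L <= k -> no_short_closed (edge A B) L ->
    (forall a p, a \in [:: u; v] -> dest a p \in [:: u; v] ->
      walk (edge A B) a p -> size p <= k -> dest a p = a) ->
    closed_walk (edge A B) y (p1 ++ d :: e :: p2) ->
    size (p1 ++ d :: e :: p2) = L -> col d != col e -> tgt d = u -> u != v ->
  #|closed_walks (edge A (swap_rel B u v)) L| < #|closed_walks (edge A B) L|.
Proof.
move=> Lk short far cp /eqP sz nde du uv.
pose phi (p : L.-tuple (dart V)) := map_tuple (swap_dart u v) p.
have phiK : involutive phi.
  move=> p; apply: val_inj; rewrite /= -map_comp -[RHS]map_id.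
  by apply: eq_map => f /=; rewrite swap_dartK.
rewrite -(card_imset _ (inv_inj phiK)); apply/proper_card/properP; split.
  apply/subsetP=> _ /imsetP[p + ->]; rewrite !inE => /existsP[x cx].
  have [|z cz] := closed_walk_swap Lk short far cx; first by rewrite size_tuple.
  by apply/existsP; exists z.
(* The given walk is not hit: at its colour change exactly one of the two darts has its end moved
   from [u] to [v]. *)
exists (Tuple sz); first by rewrite inE; apply/existsP; exists y.
apply/imsetP=> -[p + eqp]; have {}eqp: phi (Tuple sz) = p by rewrite eqp phiK.
rewrite inE -eqp => /existsP[x /and3P[]] /= + _ _.
rewrite map_cat walk_cat => /andP[_ /= /and5P[_ _ _ + _]].
have /eqP se : src e == tgt d.
  case/and3P: cp; rewrite walk_cat => /andP[_ /= /and5P[]] //.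
case: d e nde du se {cp sz eqp} => [[] [x1 y1]] [[] [x2 y2]] // _.
  by rewrite /src /tgt /= => -> ->; rewrite tpermL eq_sym (negPf uv).
by rewrite /src /tgt /= => -> ->; rewrite tpermL (negPf uv).
Qed.

End Count.

(** * Degrees and colours in the combined graph *)

Lemma edge_flip (V : finType) (A B : rel V) (d : dart V) :
  symmetric A -> symmetric B -> edge A B (flip d) = edge A B d.
Proof. by move=> Asym Bsym; case: d => [[] [x y]]; [apply: Asym | apply: Bsym]. Qed.

Lemma card_out_edge (V : finType) (A B : rel V) x :
  #|out (edge A B) x| <= #|[set y | A x y]| + #|[set y | B x y]|.
Proof.
pose F b y : dart V := (b, (x, y)).
have sub: out (edge A B) x \subset
    F true @: [set y | A x y] :|: F false @: [set y | B x y].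
  apply/subsetP=> -[b [y z]]; rewrite !inE => /andP[Ed /eqP sx].
  have {}sx : y = x := sx; rewrite {}sx in Ed *.
  by case: b Ed => Ed; apply/orP; [left | right];
    apply/imsetP; exists z; rewrite ?inE.
apply: leq_trans (subset_leq_card sub) _.
rewrite cardsU (leq_trans (leq_subr _ _)) //.
by apply: leq_add; apply: leq_imset_card.
Qed.

Lemma monochromatic_or_change (V : finType) (p : seq (dart V)) :
  (exists b, forall d, d \in p -> col d = b) \/
  exists p1 d e p2, p = p1 ++ d :: e :: p2 /\ col d != col e.
Proof.
elim: p => [|d p [[b pb]|[p1 [d' [e [p2 [-> ne]]]]]]].
- by left; exists true.
- case: p pb => [|e p] pb.
    by left; exists (col d) => f; rewrite inE => /eqP->.
  have [eq_de|ne] := eqVneq (col d) (col e); last by right; exists [::], d, e, p.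
  left; exists b => f; rewrite inE => /orP[/eqP->|/pb //].
  by rewrite eq_de pb ?mem_head.
- by right; exists (d :: p1), d', e, p2.
Qed.

Lemma graph_cycle_map (V W : finType) (s : V -> W) (r : rel W) c :
  injective s -> graph_cycle (relpre s r) c -> graph_cycle r (map s c).
Proof.
move=> s_inj; rewrite /graph_cycle /ucycleb size_map cycle_map map_inj_uniq //.
Qed.

(** * From cycles to reduced closed walks *)

Section CycleWalk.

Variables (V : finType) (A B : rel V).

Let colour (x y : V) : dart V := (A x y, (x, y)).

(** Backtracking would repeat a vertex at distance two, whatever the colours. As [a] may equal [x],
    this could only happen on [a], [y], [x], which the last hypothesis excludes. *)
Lemma reduced_colour a x q :
    uniq (a :: q) -> x \notin q -> (size q == 1 -> a != x) ->
  reduced (pairmap colour a (rcons q x)).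
Proof.
elim: q a => // y q IHq a /= /andP[ayq uq]; rewrite inE negb_or => /andP[xy xq] size1.
have := IHq y uq xq (fun _ => ltac:(by rewrite eq_sym)).
have ne z w : a != w -> colour y w != flip (colour a z).
  by apply: contraNneq => -[_ _ ->].
case: q ayq {uq xq IHq} size1 => [|z q] ayq size1 /= red.
  by rewrite ne // size1.
by rewrite red ne //; move: ayq; rewrite !inE !negb_or => /and3P[].
Qed.

Lemma closed_walk_of_cycle c :
    graph_cycle (fun x y => A x y || B x y) c ->
  exists x p, closed_walk (edge A B) x p /\ size p = size c.
Proof.
case: c => // x q /andP[size_c /andP[cyc uniq_c]].
exists x, (pairmap colour x (rcons q x)); split; last by rewrite size_pairmap size_rcons.
apply/and3P; split.
- move: cyc => /=; move: (rcons q x) => p; elim: p (x) => //= y p IHp a /andP[ray rp].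
  rewrite eqxx (IHp _ rp) /= andbT /edge /colour /col /src /tgt /=.
  by case: ifP ray.
- apply: reduced_colour => //; first by case/andP: uniq_c.
  by move: size_c => /=; case: (size q) => [|[]].
- rewrite /dest; suff -> : map (@tgt V) (pairmap colour x (rcons q x)) = rcons q x.
    by rewrite last_rcons.
  by move: (rcons q x) => p; elim: p (x) => //= y p IHp a; rewrite IHp.
Qed.

End CycleWalk.

(** * Improving a placement step by step *)

Section Packing.

Variables (G1 G2 : sgraph) (g k : nat).
Hypothesis girth1 : girth_ge (adj G1) g.
Hypothesis girth2 : girth_ge (adj G2) g.
Hypothesis card12 : #|G1| = #|G2|.
Hypothesis ball : ball_bound (max_degree G1 + max_degree G2) k < #|G1|.

(** The vertices of [G1] serve as the common vertex set; [s] tells which vertex of [G2] lies on each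
    of them. *)
Let joint (s : G1 -> G2) : pred (dart G1) := edge (adj G1) (relpre s (adj G2)).

Lemma joint_flip s d : joint s (flip d) = joint s d.
Proof.
by apply: edge_flip => [|x y]; [apply: adj_sym | rewrite /= adj_sym].
Qed.

Lemma card_out_joint s x : injective s ->
  #|out (joint s) x| <= max_degree G1 + max_degree G2.
Proof.
move=> s_inj; apply: leq_trans (card_out_edge _ _ _) _; apply: leq_add.
  exact: (leq_bigmax x).
apply: leq_trans (leq_bigmax (s x)); rewrite -(card_imset _ s_inj).
by apply/subset_leq_card/subsetP=> _ /imsetP[y + ->]; rewrite !inE.
Qed.

Lemma girth_monochromatic s b x (p : seq (dart G1)) : injective s ->
    (forall d, d \in p -> col d = b) -> p != [::] -> closed_walk (joint s) x p ->
  g <= size p.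
Proof.
move=> s_inj pb p0 cp.
have pE d : d \in p -> joint s d.
  have : walk (joint s) x p by case/and3P: cp.
  elim: p {pb p0 cp} x => //= e p IHp x /and3P[Ee _ /IHp wp].
  by rewrite inE => /predU1P[->|/wp].
pose r b := if b then adj G1 else relpre s (adj G2).
apply: (@girth_closed_walk _ _ (r b) g b x p) cp => // [y|c|d dp].
- by case: (b); apply: adj_irr.
- case: (b) => [|cyc]; first exact: (iffLR (girth_geP _ _) girth1 c).
  rewrite -(size_map s); apply: (iffLR (girth_geP _ _) girth2).
  exact: graph_cycle_map s_inj cyc.
- by split; [exact: pb | move: (pE _ dp); rewrite /joint /edge (pb _ dp) /r; case: (b)].
Qed.

Lemma exists_closed_walks_decrease s L :
    injective s -> 0 < L < g -> L <= k -> no_short_closed (joint s) L ->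
    0 < #|closed_walks (joint s) L| ->
  exists s', [/\ injective s', no_short_closed (joint s') L
    & #|closed_walks (joint s') L| < #|closed_walks (joint s) L|].
Proof.
move=> s_inj /andP[L0 Lg] Lk short /card_gt0P[p]; rewrite inE => /existsP[x cp].
have sz := size_tuple p.
have [[b pb]|[p1 [d [e [p2 [eqp nde]]]]]] := monochromatic_or_change p.
  have p0 : p != [::] :> seq _ by rewrite -size_eq0 sz -lt0n.
  by have := girth_monochromatic s_inj pb p0 cp; rewrite sz leqNgt Lg.
rewrite eqp in cp sz.
have [v far] := exists_far (joint_flip s) (tgt d) (fun y => card_out_joint y s_inj) ball.
have uv : tgt d != v by apply/negP => /eqP eq_uv; have := far [::] isT eq_uv.
exists (s \o tperm (tgt d) v).
have far2 a q : a \in [:: tgt d; v] -> dest a q \in [:: tgt d; v] ->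
    walk (joint s) a q -> size q <= k -> dest a q = a.
  rewrite !inE => /orP[]/eqP-> /orP[]/eqP // dq wq; rewrite leqNgt => /negP[].
    exact: far wq dq.
  have [r [wr dr <-]] := walk_rev (joint_flip s) wq.
  by apply: far; rewrite -dq.
split; first exact: inj_comp s_inj perm_inj.
  exact: no_short_closed_swap Lk short far2.
exact: card_closed_walks_swap Lk short far2 cp sz nde erefl uv.
Qed.

(** The exchange handles every length [L < g] with [L <= k], so the bound is [k.+1]; this excludes
    doubly covered edges already for [k = 2]. *)
Lemma exists_no_short_closed L : L <= minn g k.+1 ->
  exists s, injective s /\ no_short_closed (joint s) L.
Proof.
elim: L => [_|L IHL].
  exists (fun x => enum_val (cast_ord card12 (enum_rank x))); split=> //.
  by move=> x y /enum_val_inj/cast_ord_inj/enum_rank_inj.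
rewrite leq_min ltnS => /andP[Lg Lk].
have [|s [s_inj short]] := IHL; first by rewrite leq_min ltnW // leqW.
have [L0|L_gt0] := posnP L.
  by exists s; split=> // x p _; rewrite L0 ltnS leqn0 => /nilP.
(* Exchanges are repeated until no closed walk of length [L] is left. *)
have [n] := ubnP #|closed_walks (joint s) L|.
elim: n => // n IHn in s s_inj short *; rewrite ltnS => sz.
have [none|some] := posnP #|closed_walks (joint s) L|; last first.
  have L_lt_g : 0 < L < g by rewrite L_gt0.
  have [s' [s'_inj short' dec]] :=
    exists_closed_walks_decrease s_inj L_lt_g Lk short some.
  exact: IHn s'_inj short' (leq_trans dec sz).
exists s; split=> // x p cp; rewrite ltnS leq_eqVlt => /orP[szp|]; last exact: short cp.
move/eqP: none; rewrite cards_eq0 => /eqP/setP/(_ (Tuple szp)).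
by rewrite !inE => /negbT/existsPn/(_ x); rewrite cp.
Qed.

End Packing.

(* The displayed sum 1 + d + d(d-1) + ... presupposes 2 <= k; without this the
   claim fails, e.g. for K_{5,5} and C_10, where k = 1. *)
Theorem theorem1p1 (n g k : nat) (G1 G2 : sgraph)
    (cardG1 : #|G1| = n) (cardG2 : #|G2| = n)
    (g_gt2 : 2 < g)
    (girthG1 : girth_ge (adj G1) g) (girthG2 : girth_ge (adj G2) g)
    (k_ge2 : 2 <= k)
    (k_largest : largest_radius (max_degree G1 + max_degree G2) n k) :
  exists (V : finType) (f1 : G1 -> V) (f2 : G2 -> V),
    [/\ #|V| = n, packing f1 f2 & girth_ge (combined f1 f2) (minn g k)].
Proof.
have card12 : #|G1| = #|G2| by rewrite cardG1.
have [ball _] := k_largest; rewrite -cardG1 in ball.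
have [s [s_inj short]] :=
  exists_no_short_closed girthG1 girthG2 card12 ball (leqnn _).
have [f sK fK] : bijective s by apply: inj_card_bij s_inj _; rewrite card12.
have adj1 x y : image_adj (id : G1 -> G1) x y -> adj G1 x y.
  by case/existsP=> a /existsP[b /and3P[/eqP <- /eqP <-]].
have adj2 x y : image_adj f x y -> adj G2 (s x) (s y).
  by case/existsP=> a /existsP[b /and3P[/eqP <- /eqP <-]]; rewrite !fK.
exists G1, id, f; split=> //.
  split; [by exists id | by exists s | move=> x y; apply/negP].
  case/andP=> /adj1 xy1 /adj2 xy2.
  (* A doubly covered edge, out in one colour and back in the other, is a closed walk of length 2,
     below both [g] and [k.+1]. *)
  have := short x [:: (true, (x, y)); (false, (y, x))].
  rewrite /closed_walk /= /edge /col /src /tgt /dest /=.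
  rewrite xy1 adj_sym xy2 !eqxx => /(_ isT).
  by rewrite leq_min g_gt2 ltnS k_ge2 => /(_ isT).
apply/girth_geP => c cyc; rewrite leqNgt; apply/negP => size_c.
have cyc' : graph_cycle (fun x y => adj G1 x y || adj G2 (s x) (s y)) c.
  case/andP: cyc => c3 /andP[cyc uc]; rewrite /graph_cycle c3 /ucycleb uc andbT.
  apply: sub_cycle cyc => x y /orP[/adj1 -> //|/adj2 ->]; exact: orbT.
have [x [p [cp sp]]] := @closed_walk_of_cycle _ (adj G1) (relpre s (adj G2)) c cyc'.
have p0 : p = [::].
  by apply: short cp _; rewrite sp; apply: leq_trans size_c _; rewrite !leq_min; lia.
by case/andP: cyc; rewrite -sp p0.
Qed.
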